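(* Let $M\in\mathbb{R}^{d\times d}$ be symmetric positive definite, let $\mathbf u,\mathbf v\in\mathbb{R}^d$ be row covectors (the normals of two contact manifolds) with $\|\mathbf u\|_g=\|\mathbf v\|_g=1$ and $\mathbf u\neq\pm\mathbf v$, and let $\mathbf p\in\mathbb{R}^d$ be a covector satisfying $\langle\mathbf u,\mathbf p\rangle_g\le\langle\mathbf v,\mathbf p\rangle_g<0$. Then $$\mathbf p\,\Gamma(\mathbf u)\Gamma(\mathbf v)\Gamma(\mathbf u)=\mathbf p\,\Gamma(\mathbf v)\Gamma(\mathbf u)\Gamma(\mathbf v)\quad\text{and this common value } \mathbf p_f \text{ is feasible}$$ if and only if $$\langle\mathbf u,\mathbf v\rangle_g=-\tfrac12 .$$
   Context: Covectors (elements of the cotangent space at the impact configuration) are row vectors in $\mathbb{R}^d$, and $M$ is the (symmetric positive definite) mass matrix at that configuration. The inner product and norm on covectors are $\langle \mathbf a,\mathbf b\rangle_g=\mathbf a M^{-1}\mathbf b^{T}$ and $\|\mathbf a\|_g=\sqrt{\langle\mathbf a,\mathbf a\rangle_g}$. For a nonzero covector $\mathbf w$, the reset map is the matrix $\Gamma(\mathbf w)=I-2\frac{M^{-1}\mathbf w^{T}\mathbf w}{\mathbf w M^{-1}\mathbf w^{T}}$, acting on row covectors from the right, i.e. $\mathbf p\,\Gamma(\mathbf w)=\mathbf p-2\frac{\langle\mathbf p,\mathbf w\rangle_g}{\|\mathbf w\|_g^2}\mathbf w$. A covector $\mathbf p_f$ is feasible if $\langle\mathbf p_f,\mathbf u\rangle_g\ge0$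 and $\langle\mathbf p_f,\mathbf v\rangle_g\ge 0$. *)

(* Defs.v *)
From mathcomp Require Import all_boot all_order all_algebra.
From mathcomp Require Import reals.

Set Implicit Arguments.
Unset Strict Implicit.
Unset Printing Implicit Defensive.

Import Order.TTheory GRing.Theory Num.Theory.
Local Open Scope ring_scope.

Definition sym_posdef (R : realType) (d : nat) (M : 'M[R]_d) : Prop :=
  M^T = M /\ forall x : 'cV[R]_d, x != 0 -> 0 < (x^T *m M *m x) 0 0.

(* Covectors are row vectors; [M] is the mass matrix, acting on velocities, so
   covectors are measured with its inverse. The product is a 1 x 1 matrix,
   read as a scalar through its only entry. *)
Definition dotg (R : realType) (d : nat) (M : 'M[R]_d) (a b : 'rV[R]_d) : R :=
  (a *m invmx M *m b^T) 0 0.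

Definition normg (R : realType) (d : nat) (M : 'M[R]_d) (a : 'rV[R]_d) : R :=
  Num.sqrt (dotg M a a).

(* Acts on row covectors from the right, [p *m Gamma M w]; meaningful for
   [w != 0]. *)
Definition Gamma (R : realType) (d : nat) (M : 'M[R]_d) (w : 'rV[R]_d) :
    'M[R]_d :=
  1%:M - (2 / dotg M w w) *: (invmx M *m w^T *m w).

Definition feasible (R : realType) (d : nat) (M : 'M[R]_d)
    (u v pf : 'rV[R]_d) : Prop :=
  0 <= dotg M pf u /\ 0 <= dotg M pf v.

(* Main.v *)
Require Import Defs.
From mathcomp Require Import all_boot all_order all_algebra.
From mathcomp Require Import reals.
From mathcomp Require Import ring lra.
Import Order.TTheory GRing.Theory Num.Theory.
Local Open Scope ring_scope.

(** Put [a = <u,p>], [b = <v,p>], [c = <u,v>]. Each [Gamma] is a reflection, so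
    the two triple products can be expanded in terms of [p], [u], [v], and their
    difference is [2 (1 - 4 c^2) (a u - b v)]. Since [a u = b v] with unit
    vectors and [a, b < 0] would force [u = v], the products agree iff
    [c = 1/2] or [c = -1/2]. For [c = 1/2] the common value pairs with [u] to
    [b < 0]; for [c = -1/2] it pairs with [u], [v] to [-b], [-a]. *)

Lemma dotgC {R : realType} {d : nat} (M : 'M[R]_d) (a b : 'rV[R]_d) :
  M^T = M -> dotg M a b = dotg M b a.
Proof.
move=> MT; rewrite /dotg -[in LHS](trmxK (a *m _ *m _)) mxE.
by rewrite !trmx_mul trmxK trmx_inv MT mulmxA.
Qed.

Lemma dotgDl (R : realType) (d : nat) (M : 'M[R]_d) (a b c : 'rV[R]_d) :
  dotg M (a + b) c = dotg M a c + dotg M b c.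
Proof. by rewrite /dotg !mulmxDl mxE. Qed.

Lemma dotgZl (R : realType) (d : nat) (M : 'M[R]_d) (k : R) (a b : 'rV[R]_d) :
  dotg M (k *: a) b = k * dotg M a b.
Proof. by rewrite /dotg -!scalemxAl mxE. Qed.

Lemma dotg_unit {R : realType} {d : nat} {M : 'M[R]_d} {w : 'rV[R]_d} :
  normg M w = 1 -> dotg M w w = 1.
Proof.
rewrite /normg => w1.
(* [Num.sqrt] is 0 on negative reals, so a root equal to 1 forces a positive radicand. *)
have w_ge0 : 0 <= dotg M w w by rewrite ltW // -sqrtr_gt0 w1.
by rewrite -(sqr_sqrtr w_ge0) w1 expr1n.
Qed.

Lemma mul_Gamma_unit (R : realType) (d : nat) (M : 'M[R]_d) (p w : 'rV[R]_d) :
  dotg M w w = 1 -> p *m Gamma M w = p + (- 2 * dotg M p w) *: w.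
Proof.
move=> w1; rewrite /Gamma w1 divr1 mulmxBr mulmx1 -scalemxAr !mulmxA.
rewrite (mx11_scalar (p *m invmx M *m w^T)) mul_scalar_mx -/(dotg M p w).
by rewrite scalerA -scaleNr mulNr.
Qed.

(** [k] is the pairing of [p *m Gamma M u] with [v]. The last reflection cancels the term
    [-2 <u,p> u] of the first, so only multiples of [k] remain. *)
Lemma mul_Gamma3 (R : realType) (d : nat) (M : 'M[R]_d) (p u v : 'rV[R]_d) :
    M^T = M -> dotg M u u = 1 -> dotg M v v = 1 ->
  let k := dotg M v p - 2 * dotg M u p * dotg M u v in
  p *m Gamma M u *m Gamma M v *m Gamma M u =
  p + (4 * dotg M u v * k) *: u + (- 2 * k) *: v.
Proof.
move=> MT u1 v1 /=.
rewrite !mul_Gamma_unit // !(dotgDl, dotgZl) u1.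
rewrite (dotgC M v u) // (dotgC M p u) // (dotgC M p v) //.
by apply/rowP => i; rewrite !mxE; ring.
Qed.

(** Pairing the equation with [u] and [v] gives [a = b c] and [b = a c], where [c = <u,v>]. Hence
    [a^2 = a b c = b^2], and equal signs leave [a = b]. *)
Lemma unit_scale_inj {R : realType} {d : nat} {M : 'M[R]_d} {u v : 'rV[R]_d}
    {a b : R} :
    M^T = M -> dotg M u u = 1 -> dotg M v v = 1 -> a < 0 -> b < 0 ->
  a *: u = b *: v -> u = v.
Proof.
move=> MT u1 v1 a_lt0 b_lt0 uv.
have ac : a = b * dotg M u v.
  by rewrite -[LHS]mulr1 -u1 -dotgZl uv dotgZl (dotgC M v u).
have bc : b = a * dotg M u v by rewrite -dotgZl uv dotgZl v1 mulr1.
have eq_ab : a = b.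
  have /eqP : a ^+ 2 = b ^+ 2 by rewrite !expr2 {1}ac {3}bc; ring.
  rewrite eqf_sqr => /orP[/eqP // | /eqP ab].
  by move: a_lt0; rewrite ab oppr_lt0 ltNge ltW.
by move: uv; rewrite eq_ab; apply: scalerI; rewrite lt_eqF.
Qed.

Theorem theorem3 (R : realType) (d : nat) (M : 'M[R]_d) (u v p : 'rV[R]_d)
    (hM : sym_posdef M)
    (hu : normg M u = 1) (hv : normg M v = 1)
    (huv : u <> v) (huNv : u <> - v)
    (hle : dotg M u p <= dotg M v p) (hlt : dotg M v p < 0) :
  (p *m Gamma M u *m Gamma M v *m Gamma M u =
   p *m Gamma M v *m Gamma M u *m Gamma M v
   /\ feasible M u v (p *m Gamma M u *m Gamma M v *m Gamma M u))
  <-> dotg M u v = - (1 / 2).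
Proof.
have [MT _] := hM.
have u1 := dotg_unit hu; have v1 := dotg_unit hv.
rewrite /feasible !mul_Gamma3 // !(dotgDl, dotgZl) u1 v1.
rewrite (dotgC M v u) // (dotgC M p u) // (dotgC M p v) //.
have hlt' := le_lt_trans hle hlt.
have inj := unit_scale_inj MT u1 v1 hlt' hlt.
(* [inj] now carries the geometry, so the pairings can become arbitrary reals. *)
move: (dotg M u v) (dotg M u p) (dotg M v p) hle hlt hlt' inj.
move=> c a b hle b_lt0 a_lt0 inj; split; last first.
  (* Both products become [p - 2 (a + b) (u + v)], symmetric in [u] and [v]. *)
  move=> ->; split; last by split; lra.
  by apply/rowP => i; rewrite !mxE; field.
case=> eq3 [feas_u _].
have : (1 - 4 * c ^+ 2) *: (a *: u - b *: v) = 0.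
  apply/rowP => i; move/rowP/(_ i): eq3; rewrite !mxE => eq3.
  by lra.
move/eqP; rewrite scaler_eq0 => /orP[/eqP c2 | /eqP /subr0_eq /inj //].
have /eqP : (2 * c - 1) * (2 * c + 1) = 0 by rewrite -[RHS]oppr0 -c2; ring.
rewrite mulf_eq0 => /orP[] /eqP hc; last by lra.
(* At this root the products do agree; only feasibility excludes it. *)
have c_half : c = 1 / 2 by lra.
by move: feas_u; rewrite c_half; lra.
Qed.
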